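(* Let $\alpha,\beta\in L^\infty$. If $S_{\alpha,\beta}$ is compact, then $\alpha=\beta=0$.
   Context: $S^1=\{z\in\mathbb{C}:|z|=1\}$ carries normalized Lebesgue measure; $L^2=L^2(S^1)$, $L^\infty=L^\infty(S^1)$ (complex-valued functions). $H^2$ is the Hardy space of all $f\in L^2$ whose negative Fourier coefficients vanish, and $H^{2\bot}$ is its orthogonal complement in $L^2$. $P$ and $Q=I-P$ are the orthogonal projections of $L^2$ onto $H^2$ and $H^{2\bot}$. For $\alpha,\beta\in L^\infty$, the operator $S_{\alpha,\beta}$ on $L^2$ is $S_{\alpha,\beta}f=\alpha Pf+\beta Qf$. *)

(* Defs.v *)
From HB Require Import structures.
From mathcomp Require Import all_boot all_order all_algebra.
From mathcomp Require Import generic_quotient ring_quotient.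
From mathcomp Require Import complex.
From mathcomp Require Import mathcomp_extra boolp classical_sets functions.
From mathcomp Require Import cardinality fsbigop reals ereal.
From mathcomp Require Import topology normedtype sequences realfun exp trigo.
From mathcomp Require Import measure lebesgue_measure measurable_realfun.
From mathcomp Require Import numfun lebesgue_integral ess_sup_inf hoelder.
From mathcomp Require Import probability.

Set Implicit Arguments.
Unset Strict Implicit.
Unset Printing Implicit Defensive.
Import Order.TTheory GRing.Theory Num.Theory.
Import numFieldNormedType.Exports.
Import Normc.

Local Open Scope classical_set_scope.
Local Open Scope ring_scope.

Section normc.
Variable R : realType.

Lemma normcE (z : R[i]) :
  normc z = Num.sqrt (complex.Re z ^+ 2 + complex.Im z ^+ 2).
Proof. by case: z. Qed.

Lemma normc_ge0 (z : R[i]) : 0 <= normc z.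
Proof. by rewrite normcE sqrtr_ge0. Qed.

Lemma normc_normE (z : R[i]) : `|z| = ((normc z)%:C)%C.
Proof. by case: z. Qed.

Lemma ler_normcD (y z : R[i]) : normc (y + z) <= normc y + normc z.
Proof. by rewrite -lecR rmorphD /= -!normc_normE ler_normD. Qed.

Lemma ReM (y z : R[i]) : complex.Re (y * z) =
  complex.Re y * complex.Re z - complex.Im y * complex.Im z.
Proof. by case: y z => [a b] [c e]. Qed.

Lemma ImM (y z : R[i]) : complex.Im (y * z) =
  complex.Re y * complex.Im z + complex.Im y * complex.Re z.
Proof. by case: y z => [a b] [c e]. Qed.

End normc.

Section Lnorm_monotone.
Context d (T : measurableType d) (R : realType).
Variables (mu : {measure set T -> \bar R}) (p : \bar R).
Hypothesis p1 : (1 <= p)%E.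

Lemma ae_le_Lnorm (f g : T -> R) :
  measurable_fun setT f -> measurable_fun setT g ->
  (\forall x \ae mu, `|f x| <= `|g x|) ->
  ('N[mu]_p[EFin \o f] <= 'N[mu]_p[EFin \o g])%E.
Proof.
move=> mf mg fg; rewrite unlock /Lnorm; case: p p1 => [r r1|_|//].
  move: r1; rewrite lee_fin => r1; have r0 : 0 < r by rewrite (lt_le_trans ltr01).
  apply: gt0_ler_poweR; rewrite ?invr_ge0 ?(ltW r0)//.
  - by rewrite in_itv/= leey integral_ge0// => x _; rewrite poweR_ge0.
  - by rewrite in_itv/= leey integral_ge0// => x _; rewrite poweR_ge0.
  - apply: ae_ge0_le_integral => //=.
    + apply/measurable_EFinP.
      apply/(@measurableT_comp _ _ _ _ _ _ (fun x : R => x `^ r)) => //.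
      exact/measurableT_comp.
    + apply/measurable_EFinP.
      apply/(@measurableT_comp _ _ _ _ _ _ (fun x : R => x `^ r)) => //.
      exact/measurableT_comp.
    + apply: filterS fg => x fg _; rewrite lee_fin.
      by apply: ge0_ler_powR; rewrite ?nnegrE// ltW.
case: ifPn => // _; apply: le_ess_sup.
by apply: filterS fg => x fg /=; rewrite lee_fin.
Qed.

End Lnorm_monotone.

Section complex_Lfun.
Context d (T : measurableType d) (R : realType).
Variables (mu : {measure set T -> \bar R}) (p : \bar R).

Definition cmeasurable (f : T -> R[i]) :=
  measurable_fun setT (fun x => complex.Re (f x)) /\
  measurable_fun setT (fun x => complex.Im (f x)).

Definition cLfun : {pred T -> R[i]} :=
  mem [set f | cmeasurable f /\ finite_norm mu p (fun x => normc (f x))].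

Lemma cLfunP (f : T -> R[i]) : f \in cLfun <->
  cmeasurable f /\ finite_norm mu p (fun x => normc (f x)).
Proof. by rewrite inE. Qed.

Lemma cmeasurable_normc (f : T -> R[i]) :
  cmeasurable f -> measurable_fun setT (fun x => normc (f x)).
Proof.
move=> [mr mi]; under eq_fun do rewrite normcE.
have ms : measurable_fun setT (@Num.sqrt R).
  by apply: continuous_measurable_fun; exact: sqrt_continuous.
by apply: (measurableT_comp ms); apply: measurable_funD;
  exact: measurable_funX.
Qed.

Lemma cmeasurableD (f g : T -> R[i]) :
  cmeasurable f -> cmeasurable g -> cmeasurable (f \+ g).
Proof.
move=> [fr fi] [gr gi]; split => /=.
  rewrite (_ : (fun x => _) =
    (fun x => complex.Re (f x)) \+ (fun x => complex.Re (g x))).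
    exact: measurable_funD.
  by apply/funext => x /=; case: (f x) (g x) => [? ?] [? ?].
rewrite (_ : (fun x => _) =
  (fun x => complex.Im (f x)) \+ (fun x => complex.Im (g x))).
  exact: measurable_funD.
by apply/funext => x /=; case: (f x) (g x) => [? ?] [? ?].
Qed.

Lemma cmeasurableM (f g : T -> R[i]) :
  cmeasurable f -> cmeasurable g -> cmeasurable (f \* g).
Proof.
move=> [fr fi] [gr gi]; split => /=.
  under eq_fun do rewrite ReM.
  by apply: measurable_funB; exact: measurable_funM.
under eq_fun do rewrite ImM.
by apply: measurable_funD; exact: measurable_funM.
Qed.

Lemma cmeasurable_cst (c : R[i]) : cmeasurable (fun _ : T => c).
Proof. by split; exact: measurable_cst. Qed.

Hypothesis p1 : (1 <= p)%E.

Lemma Lnorm_normcD (f g : T -> R[i]) : cmeasurable f -> cmeasurable g ->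
  ('N[mu]_p[EFin \o (fun x => normc (f x + g x)%R)] <=
   'N[mu]_p[EFin \o (fun x => normc (f x))] +
   'N[mu]_p[EFin \o (fun x => normc (g x))])%E.
Proof.
move=> mf mg.
have nf := cmeasurable_normc mf; have ng := cmeasurable_normc mg.
apply: le_trans (eminkowski mu nf ng p1).
apply: ae_le_Lnorm => //.
- exact: cmeasurable_normc (cmeasurableD mf mg).
- exact: measurable_funD.
- apply/aeW => x /=; rewrite !ger0_norm ?addr_ge0 ?normc_ge0//.
  exact: ler_normcD.
Qed.

Lemma Lnorm_normcZ (c : R[i]) (f : T -> R[i]) : f \in cLfun ->
  ('N[mu]_p[EFin \o (fun x => normc (c * f x)%R)] =
   (normc c)%:E * 'N[mu]_p[EFin \o (fun x => normc (f x))])%E.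
Proof.
move=> /cLfunP[mf ff].
have Pf : (fun x => normc (f x)) \in Lfun mu p.
  by apply/andP; split; rewrite inE//=; exact: cmeasurable_normc.
have := @LnormZ _ _ _ mu p p1 (Lfun_Sub p1 Pf) (normc c).
rewrite ger0_norm ?normc_ge0// => <-; congr Lnorm.
by apply/funext => x /=; rewrite normcM.
Qed.

Lemma cLfun_submod_closed : submod_closed cLfun.
Proof.
split.
  apply/cLfunP; split; first exact: cmeasurable_cst.
  rewrite /finite_norm (_ : _ \o _ = cst 0%E); last first.
    by apply/funext => x /=; congr EFin; exact: normc0.
  by rewrite Lnorm0// gt_eqF// (lt_le_trans _ p1).
move=> a f g fP gP; have /cLfunP[mf ff] := fP; have /cLfunP[mg fg] := gP.
have maf : cmeasurable (fun x => a * f x).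
  by apply: cmeasurableM mf; exact: cmeasurable_cst.
apply/cLfunP; split; first exact: cmeasurableD maf mg.
apply: (le_lt_trans (Lnorm_normcD maf mg)).
rewrite lte_add_pinfty// Lnorm_normcZ//.
by rewrite lte_mul_pinfty// lee_fin normc_ge0.
Qed.

End complex_Lfun.

Section complex_LfunType.
Context d (T : measurableType d) (R : realType).
Variables (mu : {measure set T -> \bar R}) (p : \bar R) (p1 : (1 <= p)%E).

(* The exponent bound is an argument so that the closure properties, which
   depend on it, can be inferred. *)
Definition cLfun_of : {pred T -> R[i]} := let _ := p1 in cLfun mu p.

Lemma cLfun_of_submod_closed : submod_closed cLfun_of.
Proof. exact: cLfun_submod_closed. Qed.

HB.instance Definition _ := GRing.isSubmodClosed.Build _ _ cLfun_of
  cLfun_of_submod_closed.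

Record cLfunType := CLfun {
  cLfun_val :> T -> R[i];
  cLfun_valP : cLfun_val \in cLfun_of }.

HB.instance Definition _ := [isSub for cLfun_val].
HB.instance Definition _ := [Choice of cLfunType by <:].
HB.instance Definition _ := [SubChoice_isSubLmodule of cLfunType by <:].

(* Functions vanishing almost everywhere; the complex Lp space is the quotient
   by this subgroup. *)
Definition cLfun_null : {pred cLfunType} :=
  mem [set f : cLfunType | \forall x \ae mu, f x = 0].

Lemma cLfun_null_zmod_closed : zmod_closed cLfun_null.
Proof.
split=> [|f g]; rewrite !inE /=; first exact: aeW.
by move=> f0 g0; apply: filterS2 f0 g0 => x fx gx; rewrite -[LHS]/(f x - g x) fx gx subr0.
Qed.

HB.instance Definition _ := GRing.isZmodClosed.Build _ cLfun_null
  cLfun_null_zmod_closed.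

Definition cLspaceType : Type := Quotient.quot cLfun_null.
HB.instance Definition _ := GRing.Zmodule.on cLspaceType.
HB.instance Definition _ := Choice.on cLspaceType.
HB.instance Definition _ := EqQuotient.on cLspaceType.


Local Open Scope quotient_scope.

Lemma cLspace_eqP (f g : cLfunType) :
  \pi_cLspaceType f = \pi_cLspaceType g <-> \forall x \ae mu, f x = g x.
Proof.
have E : (f - g \in cLfun_null) = (f == g %[mod cLspaceType]).
  exact: Quotient.idealrBE.
split=> [fg|fg].
  have : f - g \in cLfun_null by rewrite E fg eqxx.
  rewrite inE /=; apply: filterS => x /eqP.
  by rewrite -[X in X == _]/(f x - g x) subr_eq0 => /eqP.
apply/eqP; rewrite -E inE /=; apply: filterS fg => x fg /=.
by rewrite -[LHS]/(f x - g x) fg subrr.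
Qed.

Lemma cLspace_reprP (f : cLfunType) :
  \forall x \ae mu, repr (\pi_cLspaceType f) x = f x.
Proof. by apply/cLspace_eqP; rewrite reprK. Qed.

Definition cLspace_scale (c : R[i]) (f : cLspaceType) : cLspaceType :=
  \pi_cLspaceType (c *: repr f).

Lemma cLspace_scale_pi c (f : cLfunType) :
  cLspace_scale c (\pi_cLspaceType f) = \pi_cLspaceType (c *: f).
Proof.
apply/cLspace_eqP; apply: filterS (cLspace_reprP f) => x fx.
by rewrite -[LHS]/(c * repr (\pi_cLspaceType f) x) fx.
Qed.

Lemma cLspace_piD (f g : cLfunType) :
  \pi_cLspaceType f + \pi_cLspaceType g = \pi_cLspaceType (f + g).
Proof. by rewrite [RHS]Quotient.pi_add. Qed.

Let scaleA a b (f : cLspaceType) :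
  cLspace_scale a (cLspace_scale b f) = cLspace_scale (a * b) f.
Proof.
by elim/quotW: f => f; rewrite [cLspace_scale b _]cLspace_scale_pi !cLspace_scale_pi scalerA.
Qed.

Let scale1 : left_id 1 cLspace_scale.
Proof. by elim/quotW => f; rewrite cLspace_scale_pi scale1r. Qed.

Let scaleDr : right_distributive cLspace_scale +%R.
Proof.
move=> c; elim/quotW => f; elim/quotW => g; rewrite cLspace_piD !cLspace_scale_pi.
by rewrite scalerDr cLspace_piD.
Qed.

Let scaleDl f : {morph cLspace_scale^~ f : a b / a + b}.
Proof.
by elim/quotW: f => f a b; rewrite !cLspace_scale_pi scalerDl cLspace_piD.
Qed.

HB.instance Definition _ := GRing.Zmodule_isLmodule.Build R[i] cLspaceType
  scaleA scale1 scaleDr scaleDl.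

(* The norm of a normed module over R[i] has values in R[i]; this one is the
   real number 'N[mu]_p[|f|]. *)
Definition cLspace_norm (f : cLspaceType) : R[i] :=
  ((fine 'N[mu]_p[EFin \o (fun x => normc (repr f x))])%:C)%C.

Lemma cLfunType_cmeasurable (f : cLfunType) : cmeasurable f.
Proof. by have /cLfunP[] := cLfun_valP f. Qed.

Lemma cLfunType_finite (f : cLfunType) :
  ('N[mu]_p[EFin \o (fun x => normc (f x))])%E \is a fin_num.
Proof.
have /cLfunP[_ ff] := cLfun_valP f.
by rewrite ge0_fin_numE// Lnorm_ge0.
Qed.

Lemma cLspace_norm_pi (f : cLfunType) : cLspace_norm (\pi_cLspaceType f) =
  ((fine 'N[mu]_p[EFin \o (fun x => normc (f x))])%:C)%C.
Proof.
congr ((fine _)%:C)%C; apply/eqP; rewrite eq_le.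
have mf := cmeasurable_normc (cLfunType_cmeasurable f).
have mg := cmeasurable_normc (cLfunType_cmeasurable (repr (\pi_cLspaceType f))).
by apply/andP; split; apply: ae_le_Lnorm => //;
  apply: filterS (cLspace_reprP f) => x ->.
Qed.

Let ler_cLspace_normD f g :
  cLspace_norm (f + g) <= cLspace_norm f + cLspace_norm g.
Proof.
elim/quotW: f => f; elim/quotW: g => g.
rewrite cLspace_piD !cLspace_norm_pi -rmorphD /= lecR.
rewrite -fineD ?cLfunType_finite//; apply: fine_le.
- exact: (cLfunType_finite (f + g)).
- by rewrite fin_numD !cLfunType_finite.
- by apply: Lnorm_normcD => //; exact: cLfunType_cmeasurable.
Qed.

Let cLspace_normZ c f : cLspace_norm (c *: f) = `|c| * cLspace_norm f.
Proof.
elim/quotW: f => f; rewrite [_ *: _]cLspace_scale_pi !cLspace_norm_pi normc_normE.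
rewrite -rmorphM /=; congr ((_)%:C)%C.
have := Lnorm_normcZ p1 c (cLfun_valP f).
by rewrite -[X in X = _ -> _]/('N[mu]_p[_])%E => ->; rewrite fineM// cLfunType_finite.
Qed.

Let cLspace_norm_eq0 f : cLspace_norm f = 0 -> f = 0.
Proof.
elim/quotW: f => f; rewrite cLspace_norm_pi => -[/eqP].
rewrite fine_eq0 ?cLfunType_finite// => /eqP n0.
have {n0} := Lnorm_eq0_eq0 _ (lt_le_trans lte01 p1) n0.
have mf := cmeasurable_normc (cLfunType_cmeasurable f).
move=> /(_ (measurableT_comp _ mf)) h.
rewrite [RHS](_ : _ = \pi_cLspaceType 0); last by
  rewrite -[RHS]/(\pi_(Quotient.quot cLfun_null) 0) pi_zeror.
apply/cLspace_eqP; apply: filterS (h _) => //= x /(_ I)[].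
exact: eq0_normc.
Qed.

HB.instance Definition _ := Lmodule_isNormed.Build R[i] cLspaceType
  ler_cLspace_normD cLspace_normZ cLspace_norm_eq0.

End complex_LfunType.

Section complex_Lspace_mul.
Context d (T : measurableType d) (R : realType).
Variables (mu : {measure set T -> \bar R}) (p : \bar R) (p1 : (1 <= p)%E).
Local Open Scope quotient_scope.

Lemma cLfunType_ess_bounded (a : cLfunType mu (leey 1)) :
  exists2 M : R, 0 <= M & \forall x \ae mu, normc (a x) <= M.
Proof.
have := cLfunType_finite a; rewrite unlock /Lnorm; case: ifPn => [_ fin|mu0 _].
  have ess_ae := ess_sup_ge mu (abse \o (EFin \o (fun x => normc (a x)))).
  exists `|fine (ess_sup mu (abse \o (EFin \o (fun x => normc (a x)))))| => //.
  apply: filterS ess_ae => x; rewrite -(fineK fin) lee_fin /=.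
  by rewrite ger0_norm ?normc_ge0// => /le_trans -> //; exact: ler_norm.
exists 0 => //; exists setT; split => //; apply/eqP.
by rewrite eq_le measure_ge0 andbT leNgt.
Qed.

Lemma cLfun_mul_subproof (a : cLfunType mu (leey 1)) (f : cLfunType mu p1) :
  (fun x => a x * f x) \in cLfun_of mu p1.
Proof.
have [M M0 aM] := cLfunType_ess_bounded a.
have maf := cmeasurableM (cLfunType_cmeasurable a) (cLfunType_cmeasurable f).
have mMf : cmeasurable (fun x => (M%:C)%C * f x).
  apply: cmeasurableM; last exact: cLfunType_cmeasurable.
  exact: cmeasurable_cst.
apply/cLfunP; split => //.
have := Lnorm_normcZ p1 ((M%:C)%C) (cLfun_valP f) => MfE.
apply: (@le_lt_trans _ _
    ('N[mu]_p[EFin \o (fun x => normc ((M%:C)%C * f x)%R)])%E).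
  apply: (ae_le_Lnorm p1).
  - exact: cmeasurable_normc maf.
  - exact: cmeasurable_normc mMf.
  - apply: filterS aM => x aM; rewrite !ger0_norm ?normc_ge0//.
    rewrite !normcM ler_wpM2r ?normc_ge0// (le_trans aM)//.
    by rewrite normcE /= expr0n /= addr0 sqrtr_sqr ler_norm.
rewrite MfE lte_mul_pinfty ?lee_fin ?normc_ge0//.
by have /cLfunP[] := cLfun_valP f.
Qed.

(* Product of a class of L^oo with a class of Lp. *)
Definition cLspace_mul (a : cLspaceType mu (leey 1)) (f : cLspaceType mu p1) :
    cLspaceType mu p1 :=
  \pi_(cLspaceType mu p1) (CLfun (cLfun_mul_subproof (repr a) (repr f))).

End complex_Lspace_mul.

Section circle.
Variable R : realType.

Definition circle : Type := {z : R[i] | `|z| == 1}.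
HB.instance Definition _ := Choice.on circle.

Lemma circle_expi_subproof (t : R) : `|(cos t +i* sin t)%C| == 1.
Proof. by rewrite normc_normE /= cos2Dsin2 sqrtr1. Qed.

Definition circle_expi (t : measurableTypeR R) : circle :=
  exist _ (cos t +i* sin t)%C (circle_expi_subproof t).

HB.instance Definition _ := isPointed.Build circle (circle_expi 0).

Definition circle_coord (z : circle) : R * R :=
  (complex.Re (sval z), complex.Im (sval z)).

(* Borel sets of the circle, as traces of the Borel sets of the plane. *)
HB.instance Definition _ :=
  Measurable.copy circle (g_sigma_algebra_preimageType circle_coord).

Lemma measurable_circle_expi : measurable_fun setT circle_expi.
Proof.
move=> _ _ [B mB <-]; rewrite !setTI.
have mcs : measurable_fun setT (fun t : measurableTypeR R => (cos t, sin t)).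
  apply/measurable_fun_pair.
    by apply: continuous_measurable_fun; exact: continuous_cos.
  by apply: continuous_measurable_fun; exact: continuous_sin.
by have := mcs measurableT B mB; rewrite setTI.
Qed.

HB.instance Definition _ := @isMeasurableFun.Build _ _ (measurableTypeR R) circle
  circle_expi measurable_circle_expi.

Lemma two_pi_gt0 : 0 < 2 * pi :> R.
Proof. by rewrite mulr_gt0// pi_gt0. Qed.

(* Normalized arc length: image of the uniform law on [0, 2 pi] under
   t |-> exp(i t). *)
Definition circle_measure : probability circle R :=
  distribution (uniform_prob two_pi_gt0)
    circle_expi.

(* The integral of a complex function is taken componentwise. *)
Definition circle_integral (f : circle -> R[i]) : R[i] :=
  (Rintegral circle_measure setT (fun z => complex.Re (f z)) +i*
   Rintegral circle_measure setT (fun z => complex.Im (f z)))%C.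

Definition L2 : normedModType R[i] :=
  cLspaceType circle_measure (lee1n 2 : (1 <= (2 : R)%:E)%E).

Definition Loo : normedModType R[i] :=
  cLspaceType circle_measure (leey (1 : \bar R)%E).

Definition L2_fun (f : L2) : circle -> R[i] := repr f.

Definition L2_inner (f g : L2) : R[i] :=
  circle_integral (fun z => L2_fun f z * (L2_fun g z)^*%C).

(* Functions on the circle have Fourier characters z ^ n, with conjugate
   z ^ (- n). *)
Definition fourier_coef (f : L2) (n : int) : R[i] :=
  circle_integral (fun z => L2_fun f z * sval z ^ (- n)).

Definition H2 : set L2 := [set f | forall n : int, n < 0 -> fourier_coef f n = 0].

Definition orthocomplement (V : set L2) : set L2 :=
  [set g | forall h, V h -> L2_inner g h = 0].

(* For V a closed subspace the element g below exists and is unique, so that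
   the default value 0 is irrelevant. *)
Definition orthoproj (V : set L2) (f : L2) : L2 :=
  xget 0 [set g | V g /\ orthocomplement V (f - g)].

Definition projP : L2 -> L2 := orthoproj H2.
Definition projQ (f : L2) : L2 := f - projP f.

Definition singular_op (alpha beta : Loo) (f : L2) : L2 :=
  cLspace_mul alpha (projP f) + cLspace_mul beta (projQ f).

End circle.

Definition compact_operator (K : numFieldType) (V W : normedModType K)
    (A : V -> W) : Prop :=
  precompact (A @` [set v | `|v| <= 1]).

(* Main.v *)
(** On the characters [e_n : z |-> z ^ n] the operator [S] is multiplication
    by [alpha] for [n >= 0] and by [beta] for [n < 0].  If [S] is compact, the
    functions [alpha e_n] have a cluster point [g], so for all [d > 0] and [N]
    some [N] of them lie within [d] of [g].  Adding these up, [N g] is within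
    [N d] of [alpha F], where [F] is a sum of [N] orthonormal characters, so
    that [|alpha F| <= M sqrt N] when [M] bounds [alpha].  As the [L^2] norm
    [|alpha e_n| = |alpha|] does not depend on [n], this gives
    [N (|alpha| - 2 d) <= M sqrt N] for all [N], hence [alpha = 0].  The same
    argument applies to [beta]. *)

Require Import Defs.
From mathcomp Require Import all_boot all_order all_algebra.
From mathcomp Require Import reals normedtype.
From mathcomp Require Import complex ring lra.
From mathcomp Require Import boolp classical_sets functions.
From mathcomp Require Import ereal derive exp trigo.
From mathcomp Require Import measure lebesgue_measure measurable_realfun.
From mathcomp Require Import lebesgue_integral ftc hoelder probability.

Set Implicit Arguments.
Unset Strict Implicit.
Unset Printing Implicit Defensive.
Import Order.TTheory GRing.Theory Num.Theory.
Import numFieldNormedType.Exports.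
Import Normc.

Local Open Scope classical_set_scope.
Local Open Scope ring_scope.

(** * Integrals by antiderivatives, and cluster points in precompact sets *)

Section auxiliary.
Variable R : realType.

Lemma normc_Re_Im (x : R[i]) :
  `|complex.Re x| <= normc x /\ `|complex.Im x| <= normc x.
Proof.
by rewrite Defs.normcE; split;
  rewrite -sqrtr_sqr ler_wsqrtr// ?lerDl ?lerDr sqr_ge0.
Qed.

Lemma cmeasurable_conj d (T : measurableType d) (f : T -> R[i]) :
  cmeasurable f -> cmeasurable (fun x => (f x)^*%C).
Proof.
move=> [fr fi]; split => /=.
  rewrite (_ : (fun _ => _) = fun x => complex.Re (f x))//.
  by apply/funext => x; case: (f x).
rewrite (_ : (fun _ => _) = \- (fun x => complex.Im (f x))).
  exact: measurableT_comp.
by apply/funext => x /=; case: (f x).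
Qed.

Lemma integral_derive (f F : R -> R) (a b : R) : a < b -> continuous f ->
  (forall x : R, is_derive x 1 F (f x)) ->
  (\int[lebesgue_measure]_(x in `[a, b]) (f x)%:E = (F b - F a)%:E)%E.
Proof.
move=> ab cf dF; rewrite (@continuous_FTC2 R f F)//.
- exact: continuous_subspaceT.
- have cF (x : R) : {for x, continuous F}.
    by apply/differentiable_continuous/derivable1_diffP; case: (dF x).
  split.
  + by move=> x _; case: (dF x).
  + exact: cvg_at_right_filter (cF a).
  + exact: cvg_at_left_filter (cF b).
- by move=> x _; rewrite derive1E; case: (dF x).
Qed.

(** The summand 1 keeps the integrand nonnegative, the form in which integrals over the circle are
    transferred to an interval. The same holds for the sine below. *)
Lemma integral_1Dcos (x a b : R) : x != 0 -> a < b ->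
  (\int[lebesgue_measure]_(t in `[a, b]) (1 + cos (x * t))%:E =
    ((b + x^-1 * sin (x * b)) - (a + x^-1 * sin (x * a)))%:E)%E.
Proof.
move=> x0 ab.
apply: (@integral_derive _ (fun t => t + x^-1 * sin (x * t))) => //.
- move=> t; apply: cvgD; first exact: cvg_cst.
  apply: (@continuous_comp _ _ _ (fun t => x * t) cos).
    exact: mulrl_continuous.
  exact: continuous_cos.
- move=> t; apply: is_derive_eq.
  by change (1 + x^-1 * (cos (x * t) * (x * 1)) = 1 + cos (x * t)); field.
Qed.

Lemma integral_1Dsin (x a b : R) : x != 0 -> a < b ->
  (\int[lebesgue_measure]_(t in `[a, b]) (1 + sin (x * t))%:E =
    ((b - x^-1 * cos (x * b)) - (a - x^-1 * cos (x * a)))%:E)%E.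
Proof.
move=> x0 ab.
apply: (@integral_derive _ (fun t => t - x^-1 * cos (x * t))) => //.
- move=> t; apply: cvgD; first exact: cvg_cst.
  apply: (@continuous_comp _ _ _ (fun t => x * t) sin).
    exact: mulrl_continuous.
  exact: continuous_sin.
- move=> t; apply: is_derive_eq.
  by change (1 - x^-1 * (- sin (x * t) * (x * 1)) = 1 + sin (x * t)); field.
Qed.

(** The sequence clusters at some [g] in the compact closure of [A], so every ball around [g] is
    visited at arbitrarily large indices. Finitely many distinct indices are all that the later
    averaging uses. *)
Lemma precompact_cluster_seq (K : numFieldType) (V : normedModType K)
    (A : set V) (u : nat -> V) : precompact A -> (forall n, A (u n)) ->
  exists g : V, forall e : K, 0 < e -> forall N : nat, exists2 s : seq nat,
    uniq s & size s = N /\ forall n, n \in s -> `|g - u n| < e.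
Proof.
rewrite precompactE => cA Au.
have [g [_ cg]] : closure A `&` cluster (u @ \oo) !=set0.
  by apply: cA; exists 0%N => // n _ /=; exact/subset_closure.
exists g => e e0; elim=> [|N [s us [sN su]]]; first by exists [::].
(* An index beyond the maximum of [s] is new, so the list stays duplicate-free. *)
have : (u @ \oo) (u @` [set n | (\max_(m <- s) m < n)%N]).
  by exists (\max_(m <- s) m).+1 => // n /= sn; exists n.
move=> /cg /(_ (nbhsx_ballx g e e0)) [_ [[n /= sn <-]]].
rewrite -ball_normE /= => gn.
exists (n :: s) => /=.
  rewrite us andbT; apply/negP => ns.
  by move: sn; rewrite ltnNge leq_bigmax_seq.
split; first by rewrite sN.
by move=> m; rewrite inE => /predU1P[->//|]; exact: su.
Qed.

End auxiliary.

(** * Integer powers on the circle and their integrals *)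

Section circle_characters.
Variable R : realType.
Local Notation mu := (circle_measure R).

Lemma circle_unit (z : circle R) : sval z != 0.
Proof.
by case: z => z /= /eqP z1; rewrite -normr_eq0 z1 oner_eq0.
Qed.

Lemma circle_conj (z : circle R) : ((sval z)^*)%C = (sval z)^-1.
Proof.
have z0 := circle_unit z; apply: (mulfI z0); rewrite divff//.
(* This passes from the conjugation of [R[i]] to the generic one, for which [normCK] gives [z] times
   its conjugate as [|z| ^+ 2 = 1]. *)
have -> : (sval z)^*%C = (sval z)^* by [].
by rewrite -normCK; case: z {z0} => z /= /eqP ->; rewrite expr1n.
Qed.

Lemma circle_conjX (z : circle R) (n : int) :
  ((sval z ^ n)^*)%C = sval z ^ (- n).
Proof.
have -> : (sval z ^ n)^*%C = (sval z ^ n)^* by [].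
rewrite fmorphXz /=.
have -> : (sval z)^* = (sval z)^*%C by [].
by rewrite circle_conj exprz_inv.
Qed.

Lemma normc_circleX (z : circle R) (n : int) : normc (sval z ^ n) = 1.
Proof.
have z1 : `|sval z| = 1 by case: z => z /= /eqP.
apply: complexI; rewrite -normc_normE.
case: n => m; first by rewrite normrX z1 expr1n.
by rewrite NegzE -exprz_inv normrX normfV z1 invr1 expr1n.
Qed.

Lemma circleX_sqr (z : circle R) (n : int) :
  complex.Re (sval z ^ n) ^+ 2 + complex.Im (sval z ^ n) ^+ 2 = 1.
Proof.
have := normc_circleX z n; rewrite Defs.normcE => /(congr1 (fun x => x ^+ 2)).
by rewrite sqr_sqrtr ?addr_ge0 ?sqr_ge0// expr1n.
Qed.

(** De Moivre's formula: addition formulas for natural exponents, then conjugation for negative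
    ones. *)
Lemma circle_expiX (t : R) (n : int) : sval (circle_expi t) ^ n =
  (cos (n%:~R * t) +i* sin (n%:~R * t))%C.
Proof.
have natE (m : nat) : sval (circle_expi t) ^+ m =
    (cos (m%:R * t) +i* sin (m%:R * t))%C.
  elim: m => [|m ih]; first by rewrite mul0r cos0 sin0.
  rewrite exprS ih /= -natr1 mulrDl mul1r cosD sinD.
  by apply/eqP; rewrite eq_complex /=; apply/andP; split; apply/eqP; ring.
case: n => m; first by rewrite -exprnP natE.
rewrite NegzE -circle_conjX -exprnP natE /= rmorphN /=.
by rewrite mulNr cosN sinN.
Qed.

Lemma measurable_circle_coord : measurable_fun setT (@circle_coord R).
Proof.
by move=> _ B mB; rewrite setTI; exists B => //; rewrite setTI.
Qed.

Lemma cmeasurable_circleX (n : int) :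
  cmeasurable (fun z : circle R => sval z ^ n).
Proof.
have natE (m : nat) : cmeasurable (fun z : circle R => sval z ^+ m).
  elim: m => [|m ih]; first exact: cmeasurable_cst.
  under eq_fun do rewrite exprS.
  apply: cmeasurableM ih; split.
    exact: (measurableT_comp measurable_fst measurable_circle_coord).
  exact: (measurableT_comp measurable_snd measurable_circle_coord).
case: n => m; first exact: natE.
rewrite NegzE; under eq_fun do rewrite -circle_conjX.
exact/cmeasurable_conj/natE.
Qed.

Lemma Rintegral_circle_cst (c : R) : Rintegral mu setT (fun=> c) = c.
Proof.
have := @probability_setT _ _ _ mu => mu1.
by rewrite Rintegral_cst// [fine _](_ : _ = 1) ?mulr1 //= [X in fine X]mu1.
Qed.

(* The integral against [uniform_prob] is only computed for nonnegative
   functions, whence the shift by [c]. *)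
Lemma Rintegral_circle_ge (h : circle R -> R) (c : R) : measurable_fun setT h ->
  (forall z, 0 <= c + h z) -> mu.-integrable setT (EFin \o h) ->
  c + Rintegral mu setT h =
  (2 * pi)^-1 * fine (\int[lebesgue_measure]_(t in `[0%R, (2 * pi)%R])
    (c + h (circle_expi t))%:E).
Proof.
move=> mh ch ih.
have mch : measurable_fun setT (fun z => c + h z) by exact: measurable_funD.
transitivity (Rintegral mu setT (fun z => c + h z)).
  rewrite RintegralD//; last exact: finite_measure_integrable_cst.
  by rewrite Rintegral_circle_cst.
rewrite /Rintegral /circle_measure ge0_integral_distribution//=; last first.
  exact/measurable_EFinP.
rewrite integral_uniform//=; last 2 first.
- apply/measurable_EFinP; apply: (measurableT_comp mch).
  exact: measurable_circle_expi.
- by move=> y; rewrite lee_fin.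
rewrite subr0; set I := (\int[_]_(_ in _) _)%E.
have pi0 : 0 < (2 * pi : R)^-1 by rewrite invr_gt0 two_pi_gt0.
(* The factor also leaves [fine] when [I] is infinite, both sides being 0. *)
case: I => [r| |] //=.
  by rewrite gt0_muley ?lte_fin// mulr0.
by rewrite gt0_muleNy ?lte_fin// mulr0.
Qed.

Lemma integrable_circleX (n : int) :
  mu.-integrable setT (EFin \o (fun z => complex.Re (sval z ^ n))) /\
  mu.-integrable setT (EFin \o (fun z => complex.Im (sval z ^ n))).
Proof.
have [mr mi] := cmeasurable_circleX n.
have i1 := finite_measure_integrable_cst mu 1 (@measurableT _ (circle R)).
split; apply: le_integrable i1 => //; try exact/measurable_EFinP.
- move=> z _ /=; rewrite lee_fin normr1 -(ler_pXn2r (ltn0Sn 1)) ?nnegrE//.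
  by rewrite real_normK ?num_real// expr1n -(circleX_sqr z n) lerDl sqr_ge0.
- move=> z _ /=; rewrite lee_fin normr1 -(ler_pXn2r (ltn0Sn 1)) ?nnegrE//.
  by rewrite real_normK ?num_real// expr1n -(circleX_sqr z n) lerDr sqr_ge0.
Qed.

Lemma circle_integralX (n : int) :
  circle_integral (fun z : circle R => sval z ^ n) = (n == 0)%:R.
Proof.
have [->|n0] := eqVneq n 0.
  rewrite /circle_integral; under eq_Rintegral do rewrite expr0z /=.
  under [in X in (_ +i* X)%C]eq_Rintegral do rewrite expr0z /=.
  by rewrite !Rintegral_circle_cst.
have [mr mi] := cmeasurable_circleX n.
have [ir ii] := integrable_circleX n.
have leN1 (z : circle R) : 0 <= 1 + complex.Re (sval z ^ n) /\
    0 <= 1 + complex.Im (sval z ^ n).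
  by have := circleX_sqr z n; split; nra.
rewrite /circle_integral; apply/eqP; rewrite eq_complex /=.
(* Adding 1 to both components makes the integrands nonnegative, as [leN1] states. *)
rewrite -(inj_eq (addrI 1)) -[X in _ && X](inj_eq (addrI 1)).
rewrite Rintegral_circle_ge //; last by move=> z; case: (leN1 z).
rewrite Rintegral_circle_ge //; last by move=> z; case: (leN1 z).
set x : R := n%:~R.
have x0 : x != 0 by rewrite intr_eq0.
under eq_integral do rewrite circle_expiX /=.
under [in X in _ && X]eq_integral do rewrite circle_expiX /=.
rewrite integral_1Dcos ?two_pi_gt0// integral_1Dsin ?two_pi_gt0//.
(* [sin (2 pi n) = 0] and [cos (2 pi n) = 1] as [exp (2 i pi) ^ n = 1 ^ n]. *)
have := circle_expiX (2 * pi) n.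
rewrite (_ : sval (circle_expi (2 * pi)) = 1); last first.
  by rewrite /= mulr_natl cos2pi sin2pi.
rewrite exp1rz => -[<- <-] /=; rewrite !mulr0 cos0 sin0 !mulr0 !addr0 subr0 add0r.
rewrite opprK subrK.
by rewrite mulVf ?eqxx// gt_eqF ?two_pi_gt0.
Qed.

(** * Complex integrals and the inner product of [L2] *)

Local Notation two := (lee1n 2 : (1 <= (2 : R)%:E)%E).
Local Notation fn := (cLfunType mu two).
Local Notation L2cls := (\pi_(cLspaceType mu two))%qT.

Definition cintegrable (f : circle R -> R[i]) :=
  mu.-integrable setT (EFin \o (fun z => complex.Re (f z))) /\
  mu.-integrable setT (EFin \o (fun z => complex.Im (f z))).

Lemma circle_integralD (f g : circle R -> R[i]) :
  cintegrable f -> cintegrable g ->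
  circle_integral (fun z => f z + g z) = circle_integral f + circle_integral g.
Proof.
move=> [fr fi] [gr gi]; rewrite /circle_integral.
by congr (_ +i* _)%C; rewrite -RintegralD//; apply: eq_Rintegral => z _;
  case: (f z) (g z) => [a b] [c e].
Qed.

Lemma circle_integral_conj (f : circle R -> R[i]) : cintegrable f ->
  circle_integral (fun z => (f z)^*%C) = (circle_integral f)^*%C.
Proof.
move=> [fr fi]; rewrite /circle_integral /=; congr (_ +i* _)%C.
  by apply: eq_Rintegral => z _; case: (f z).
rewrite -mulN1r -RintegralZl//; apply: eq_Rintegral => z _.
by rewrite mulN1r; case: (f z).
Qed.

Lemma ae_eq_Rintegral (f g : circle R -> R) : measurable_fun setT f ->
  measurable_fun setT g -> (\forall z \ae mu, f z = g z) ->
  Rintegral mu setT f = Rintegral mu setT g.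
Proof.
move=> mf mg fg; rewrite /Rintegral; congr fine; apply: ae_eq_integral => //.
- exact/measurable_EFinP.
- exact/measurable_EFinP.
- by apply: filterS fg => z /= -> _.
Qed.

Lemma ae_eq_circle_integral (f g : circle R -> R[i]) :
  cmeasurable f -> cmeasurable g ->
  (\forall z \ae mu, f z = g z) -> circle_integral f = circle_integral g.
Proof.
move=> [fr fi] [gr gi] fg; rewrite /circle_integral; congr (_ +i* _)%C;
  by apply: ae_eq_Rintegral => //; apply: filterS fg => z ->.
Qed.

Lemma L2_fun_integrable_sqr (f : fn) :
  mu.-integrable setT (EFin \o (fun z => normc (f z) ^+ 2)).
Proof.
have mf := cmeasurable_normc (cLfunType_cmeasurable f).
have := cLfunType_finite f; rewrite unlock /Lnorm.
set I := (\int[mu]_x _)%E => Ifin.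
apply/integrableP; split; first exact/measurable_EFinP/measurable_funX.
have <- : I = (\int[mu]_x `|((normc (f x) ^+ 2)%:E)|)%E.
  apply: eq_integral => z _ /=.
  by rewrite ger0_norm ?normc_ge0// ger0_norm ?sqr_ge0// powR_mulrn// normc_ge0.
have I0 : (0 <= I)%E by apply: integral_ge0 => z _; rewrite poweR_ge0.
(* Finiteness is known for the square root of [I], and it excludes [I = +oo]. *)
case: (I) I0 Ifin => [r| |] // _; first by rewrite ltry.
by rewrite poweRyr// invr_neq0.
Qed.

(** Both components are dominated by [|f|^2 + |g|^2], which is integrable. Additivity of the inner
    product rests on this. *)
Lemma cintegrable_mul_conj (f g : fn) : cintegrable (fun z => f z * (g z)^*%C).
Proof.
have [mr mi] := cmeasurableM (cLfunType_cmeasurable f)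
  (cmeasurable_conj (cLfunType_cmeasurable g)).
pose b z := normc (f z) ^+ 2 + normc (g z) ^+ 2.
have fgb z : normc (f z * (g z)^*%C) <= b z.
  have := normc_ge0 (f z); have := normc_ge0 (g z).
  rewrite normcM /b; have -> : normc (g z)^*%C = normc (g z).
    by rewrite !Defs.normcE; case: (g z) => a c /=; rewrite sqrrN.
  by nra.
have br z : `|complex.Re (f z * (g z)^*%C)| <= b z.
  by apply: le_trans (fgb z); case: (normc_Re_Im (f z * (g z)^*%C)).
have bi z : `|complex.Im (f z * (g z)^*%C)| <= b z.
  by apply: le_trans (fgb z); case: (normc_Re_Im (f z * (g z)^*%C)).
have ib : mu.-integrable setT (EFin \o b).
  by apply: eq_integrable
    (integrableD _ (L2_fun_integrable_sqr f) (L2_fun_integrable_sqr g)).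
split; apply: le_integrable ib => //; try exact/measurable_EFinP.
- by move=> z _; rewrite lee_fin (le_trans (br z))// ler_norm.
- by move=> z _; rewrite lee_fin (le_trans (bi z))// ler_norm.
Qed.

(** [L2_inner] is defined through chosen representatives; almost everywhere equality allows any
    others. *)
Lemma L2_inner_pi (f g : fn) :
  L2_inner (L2cls f) (L2cls g) = circle_integral (fun z => f z * (g z)^*%C).
Proof.
apply: ae_eq_circle_integral; last first.
  apply: filterS2 (cLspace_reprP f) (cLspace_reprP g) => z.
  by rewrite /L2_fun => -> ->.
all: by apply: cmeasurableM; [|apply: cmeasurable_conj];
  exact: cLfunType_cmeasurable.
Qed.

Lemma L2_innerDl (f g h : L2 R) :
  L2_inner (f + g) h = L2_inner f h + L2_inner g h.
Proof.
elim/quotW: f => f; elim/quotW: g => g; elim/quotW: h => h.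
rewrite cLspace_piD !L2_inner_pi.
rewrite -circle_integralD; try exact: cintegrable_mul_conj.
by congr circle_integral; apply/funext => z; rewrite -mulrDl.
Qed.

Lemma L2_innerC (f g : L2 R) : L2_inner g f = (L2_inner f g)^*%C.
Proof.
elim/quotW: f => f; elim/quotW: g => g.
rewrite !L2_inner_pi -circle_integral_conj; last exact: cintegrable_mul_conj.
congr circle_integral; apply/funext => z.
by case: (f z) (g z) => [a b] [c e] /=; congr (_ +i* _)%C; ring.
Qed.

Lemma L2_inner_self (f : L2 R) : L2_inner f f = `|f| ^+ 2.
Proof.
elim/quotW: f => f; rewrite L2_inner_pi.
rewrite [X in X ^+ 2]cLspace_norm_pi.
have i2 := L2_fun_integrable_sqr f.
have n2 : ('N[mu]_2[EFin \o (fun z => normc (f z))] `^ 2 =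
    \int[mu]_z (normc (f z) ^+ 2)%:E)%E.
  rewrite poweR_Lnorm//; apply: eq_integral => z _ /=.
  by rewrite ger0_norm ?normc_ge0// powR_mulrn// normc_ge0.
rewrite -rmorphXn /= -powR_mulrn ?fine_ge0 ?Lnorm_ge0//.
rewrite -fine_poweR n2 /circle_integral.
congr (_ +i* _)%C.
  apply: eq_Rintegral => z _.
  rewrite Defs.normcE sqr_sqrtr ?addr_ge0 ?sqr_ge0//.
  by case: (f z) => a b /=; ring.
(* The imaginary part of [f z] times its conjugate vanishes pointwise. *)
rewrite -[RHS](Rintegral_circle_cst 0); apply: eq_Rintegral => z _.
by case: (f z) => a b /=; ring.
Qed.

Lemma L2_innerBl (f g h : L2 R) :
  L2_inner (f - g) h = L2_inner f h - L2_inner g h.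
Proof. by rewrite -[f in RHS](subrK g) (L2_innerDl (f - g)) addrK. Qed.

Lemma L2_inner0l (h : L2 R) : L2_inner 0 h = 0.
Proof. by rewrite -[0 in LHS](subrr 0) L2_innerBl subrr. Qed.

Lemma L2_innerDr (f g h : L2 R) :
  L2_inner h (f + g) = L2_inner h f + L2_inner h g.
Proof. by rewrite !(L2_innerC _ h) L2_innerDl rmorphD. Qed.

Lemma L2_inner0r (h : L2 R) : L2_inner h 0 = 0.
Proof. by rewrite L2_innerC L2_inner0l rmorph0. Qed.

Lemma L2_inner_eq0 (f : L2 R) : L2_inner f f = 0 -> f = 0.
Proof. by rewrite L2_inner_self => /eqP; rewrite sqrf_eq0 normr_eq0 => /eqP. Qed.

Lemma L2_normD_orth (f g : L2 R) : L2_inner f g = 0 ->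
  `|f + g| ^+ 2 = `|f| ^+ 2 + `|g| ^+ 2.
Proof.
move=> fg; rewrite -!L2_inner_self !L2_innerDl !L2_innerDr fg (L2_innerC f g) fg.
by rewrite rmorph0 addr0 add0r.
Qed.

(** * Orthonormal characters and their projections *)

Lemma circleX_cLfun (n : int) :
  (fun z : circle R => sval z ^ n) \in cLfun_of mu two.
Proof.
apply/cLfunP; split; first exact: cmeasurable_circleX.
rewrite /finite_norm (_ : _ \o _ = cst 1%E); last first.
  by apply/funext => z /=; rewrite normc_circleX.
rewrite Lnorm_cst1; have := @probability_setT _ _ _ mu => mu1.
by rewrite [X in poweR X _]mu1 poweR1r ltry.
Qed.

Definition circle_char (n : int) : L2 R := L2cls (CLfun (circleX_cLfun n)).

(** On the circle [z ^ (- n)] is the conjugate of [z ^ n]. Membership in [H2] thus becomes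
    orthogonality to the characters of negative index. *)
Lemma fourier_coef_char (f : L2 R) (n : int) :
  fourier_coef f n = L2_inner f (circle_char n).
Proof.
elim/quotW: f => f; rewrite L2_inner_pi; apply: ae_eq_circle_integral.
- by apply: cmeasurableM; [exact: cLfunType_cmeasurable|exact: cmeasurable_circleX].
- apply: cmeasurableM; [exact: cLfunType_cmeasurable|apply: cmeasurable_conj].
  exact: cmeasurable_circleX.
- by apply: filterS (cLspace_reprP f) => z fz; rewrite /L2_fun fz /= circle_conjX.
Qed.

Lemma L2_inner_char (m n : int) :
  L2_inner (circle_char m) (circle_char n) = (m == n)%:R.
Proof.
rewrite L2_inner_pi -(subr_eq0 m n) -circle_integralX; congr circle_integral.
by apply/funext => z /=; rewrite circle_conjX expfzDr// circle_unit.
Qed.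

Lemma L2_norm_char (n : int) : `|circle_char n| = 1.
Proof.
apply: (@pexpIrn _ 2) => //; rewrite ?nnegrE//.
by rewrite expr1n -L2_inner_self L2_inner_char eqxx.
Qed.

(** Pythagoras, by induction: a character outside [s] is orthogonal to the sum over [s]. *)
Lemma L2_norm_sum_char (s : seq int) : uniq s ->
  `|\sum_(n <- s) circle_char n| ^+ 2 = (size s)%:R.
Proof.
elim: s => [|n s ih] /=; first by rewrite big_nil normr0 expr0n.
move=> /andP[ns us]; rewrite big_cons L2_normD_orth.
  by rewrite ih// L2_norm_char expr1n -nat1r.
elim: s ns {ih us} => [|m s ih] /=; first by rewrite big_nil L2_inner0r.
rewrite inE negb_or => /andP[nm ns].
by rewrite big_cons L2_innerDr L2_inner_char (negbTE nm) add0r ih.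
Qed.

(** As [g] is admissible, [xget] returns some admissible [h]. Then [h - g] lies in [V] and, being
    [(f - g) - (f - h)], is orthogonal to [V], hence to itself. *)
Lemma orthoprojE (V : set (L2 R)) (f g : L2 R) :
  (forall h k, V h -> V k -> V (h - k)) ->
  V g -> orthocomplement V (f - g) -> orthoproj V f = g.
Proof.
move=> VB Vg Og; rewrite /orthoproj; set h := xget _ _.
have [Vh Oh] : V h /\ orthocomplement V (f - h).
  by apply: (@xgetPex _ 0 [set k | V k /\ orthocomplement V (f - k)]); exists g.
have Vhg := VB _ _ Vh Vg.
have hg0 : L2_inner (h - g) (h - g) = 0.
  rewrite [X in L2_inner X _](_ : _ = f - g - (f - h)).
    by rewrite L2_innerBl Og// Oh// subrr.
  by rewrite opprB [RHS]addrC addrA subrK.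
by apply: subr0_eq; exact: L2_inner_eq0.
Qed.

Lemma H2B (f g : L2 R) : H2 f -> H2 g -> H2 (f - g).
Proof.
move=> Hf Hg n n0; rewrite fourier_coef_char L2_innerBl -!fourier_coef_char.
by rewrite Hf// Hg// subrr.
Qed.

Lemma projP_char_ge0 (n : int) :
  0 <= n -> projP (circle_char n) = circle_char n.
Proof.
move=> n0; apply: orthoprojE; first exact: H2B.
- move=> k k0; rewrite fourier_coef_char L2_inner_char.
  by case: eqVneq => // nk; move: k0; rewrite -nk ltNge n0.
- by move=> h _; rewrite subrr L2_inner0l.
Qed.

(** The [n]-th Fourier coefficient of every element of [H2] vanishes, so this character is
    orthogonal to [H2]. *)
Lemma projP_char_lt0 (n : int) : n < 0 -> projP (circle_char n) = 0.
Proof.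
move=> n0; apply: orthoprojE; first exact: H2B.
- by move=> k k0; rewrite fourier_coef_char L2_inner0l.
- move=> h Hh; rewrite subr0 L2_innerC -fourier_coef_char Hh//.
  by rewrite rmorph0.
Qed.

(** * Multiplication by a bounded function *)

Lemma cLspace_mulDr (a : Loo R) (f g : L2 R) :
  cLspace_mul a (f + g) = cLspace_mul a f + cLspace_mul a g.
Proof.
elim/quotW: f => f; elim/quotW: g => g; rewrite cLspace_piD [RHS]cLspace_piD.
apply/cLspace_eqP.
apply: filterS3 (cLspace_reprP f) (cLspace_reprP g) (cLspace_reprP (f + g)).
move=> z fz gz fgz /=.
rewrite fgz -[RHS]/(_ * repr (L2cls f) z + _ * repr (L2cls g) z) fz gz -mulrDr.
by [].
Qed.

Lemma cLspace_mul0r (a : Loo R) : cLspace_mul a 0 = 0 :> L2 R.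
Proof.
by apply: (addrI (cLspace_mul a 0)); rewrite -cLspace_mulDr !addr0.
Qed.

Lemma cLspace_mul_sumr (a : Loo R) I (s : seq I) (F : I -> L2 R) :
  cLspace_mul a (\sum_(i <- s) F i) = \sum_(i <- s) cLspace_mul a (F i).
Proof.
by apply: (big_morph _ (cLspace_mulDr a)); exact: cLspace_mul0r.
Qed.

Lemma cLspace_mul_bounded (a : Loo R) : exists2 M : R, 0 <= M &
  forall f : L2 R, `|cLspace_mul a f| <= M%:C%C * `|f|.
Proof.
have [M M0 aM] := cLfunType_ess_bounded (repr a).
exists M => // f.
(* Written as the norm of [M f], the right side can be compared with the left through a pointwise
   bound holding almost everywhere. *)
rewrite -[M%:C%C]ger0_norm ?ler0c// -normrZ.
rewrite -(reprK f) [M%:C%C *: _]cLspace_scale_pi.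
rewrite [leLHS]cLspace_norm_pi [leRHS]cLspace_norm_pi lecR.
apply: fine_le; rewrite ?cLfunType_finite//.
apply: (ae_le_Lnorm (lee1n 2));
  try by apply: cmeasurable_normc; exact: cLfunType_cmeasurable.
apply: filterS2 aM (cLspace_reprP (repr f)) => z az fz /=.
rewrite fz !ger0_norm ?normc_ge0//.
rewrite -[X in _ <= X]/(normc (M%:C%C * repr f z)) !normcM ler_wpM2r ?normc_ge0//.
by rewrite [leRHS]Defs.normcE /= expr0n /= addr0 sqrtr_sqr ger0_norm.
Qed.

(** Characters have modulus 1, so the moduli of the two products agree almost everywhere. *)
Lemma cLspace_mul_char_norm (a : Loo R) (n : int) :
  `|cLspace_mul a (circle_char n)| = `|cLspace_mul a (circle_char 0)|.
Proof.
rewrite [LHS]cLspace_norm_pi [RHS]cLspace_norm_pi; congr (fine _)%:C%C.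
have E m : \forall z \ae mu,
    normc (repr a z * repr (circle_char m) z) = normc (repr a z).
  apply: filterS (cLspace_reprP (CLfun (circleX_cLfun m))) => z ->.
  by rewrite /= normcM normc_circleX mulr1.
apply/eqP; rewrite eq_le; apply/andP; split.
all: apply: (ae_le_Lnorm (lee1n 2));
  try by apply: cmeasurable_normc; exact: cLfunType_cmeasurable.
all: by apply: filterS2 (E n) (E 0) => z /= -> ->.
Qed.

Lemma cLspace_mul_char_eq0 (a : Loo R) (n : int) :
  cLspace_mul a (circle_char n) = 0 -> a = 0.
Proof.
rewrite -{2}(reprK a) => a0.
have -> : 0 = (\pi_(Loo R) 0)%qT :> Loo R.
  by rewrite -[RHS]/((\pi_(Quotient.quot _) 0)%qT) pi_zeror.
apply/cLspace_eqP.
have /cLspace_eqP : cLspace_mul a (circle_char n) = L2cls 0.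
  by rewrite a0 -[RHS]/((\pi_(Quotient.quot _) 0)%qT) pi_zeror.
move=> afn; apply: filterS2 (cLspace_reprP (CLfun (circleX_cLfun n))) afn.
move=> z /= -> /eqP.
by rewrite mulf_eq0 expfz_eq0 (negbTE (circle_unit z)) andbF orbF => /eqP.
Qed.

(** The enumeration [k] lets one argument serve both the nonnegative and the negative characters;
    its injectivity makes the selected characters orthonormal. *)
Lemma cLspace_mul_char_precompact (a : Loo R) (k : nat -> int) (A : set (L2 R)) :
  injective k -> precompact A ->
  (forall n, A (cLspace_mul a (circle_char (k n)))) ->
  a = 0.
Proof.
move=> kI pA Aak; pose c := `|cLspace_mul a (circle_char 0)|.
have [M M0 aM] := cLspace_mul_bounded a.
have [g gP] := precompact_cluster_seq pA Aak.
suff : c = 0 by move=> /normr0_eq0; exact: cLspace_mul_char_eq0.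
apply/eqP/negPn/negP => c0.
have {}c0 : 0 < c by rewrite lt_neqAle eq_sym c0 normr_ge0.
(* With this choice [|g| >= c - d] leaves [|g| - d >= 2 d], a positive lower bound per selected
   character. *)
pose d := c / 4%:R.
have d0 : 0 < d by rewrite divr_gt0.
have cd : c = d + d + (d + d) by rewrite /d; field.
have cg : c <= `|g| + d.
  have [s _ [sN sg]] := gP _ d0 1%N; case: s sN sg => [//|n s _ sg].
  rewrite /c -(cLspace_mul_char_norm a (k n)) -lerBlDl.
  by rewrite (le_trans (lerB_dist _ _))// distrC ltW// sg ?mem_head.
(* This is [2 d N <= |a F| <= M |F|], squared because only [|F| ^+ 2 = N] is at hand. *)
have key (N : nat) : (N%:R * (d + d)) ^+ 2 <= M%:C%C ^+ 2 * N%:R.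
  have [s us [<- sg]] := gP _ d0 N.
  pose F := \sum_(n <- s) circle_char (k n).
  have nF : `|F| ^+ 2 = (size s)%:R.
    rewrite /F -(big_map k xpredT circle_char) L2_norm_sum_char ?size_map//.
    by rewrite map_inj_uniq.
  have sgF : `|g *+ size s - cLspace_mul a F| <= (size s)%:R * d.
    rewrite cLspace_mul_sumr.
    elim: (s) sg => [_|n s' ih sg].
      by rewrite big_nil mulr0n subrr normr0 mul0r.
    rewrite big_cons /= mulrS opprD addrACA -[(size s').+1%:R]nat1r mulrDl mul1r.
    apply: le_trans (ler_normD _ _) _; apply: lerD.
      by rewrite ltW// sg ?mem_head.
    by apply: ih => m ms; apply: sg; rewrite inE ms orbT.
  have dd0 : 0 <= d + d by rewrite ltW// addr_gt0.
  have Mc0 : 0 <= M%:C%C by rewrite ler0c.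
  rewrite -[X in _ <= _ * X]nF -exprMn ler_pXn2r ?nnegrE ?mulr_ge0 ?ler0n//.
  apply: le_trans (aM F).
  (* With [N] the size of [s], the claim becomes [N c - N d <= |a F| + N d], and [N |g|] lies
     between the two sides by [cg] and [sgF]. *)
  rewrite -(lerD2r ((size s)%:R * (d + d))) -mulrDr -cd mulrDr addrA -lerBlDr.
  rewrite (le_trans _ (lerD (lexx _) sgF))//.
  apply: (@le_trans _ _ ((size s)%:R * `|g|)).
    by rewrite lerBlDr -mulrDr ler_wpM2l.
  by rewrite mulr_natl -normrMn -{1}(subrKC (cLspace_mul a F) (g *+ size s))
    ler_normD.
(* Cancelling one factor [N] bounds all naturals by a fixed number. *)
have {key} key (N : nat) : N%:R <= M%:C%C ^+ 2 / (d + d) ^+ 2.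
  have [->|N0] := posnP N.
    by rewrite divr_ge0 ?exprn_ge0 ?ler0c// ltW// addr_gt0.
  rewrite ler_pdivlMr ?exprn_gt0 ?addr_gt0//.
  rewrite -(ler_pM2r (_ : 0 < N%:R)) ?ltr0n//.
  by apply: le_trans (key N); rewrite exprMn expr2 mulrAC.
set q := _ / _ in key.
(* The bound [q] lies in [R[i]], whose order compares real parts; the Archimedean property of [R]
   then gives the contradiction. *)
have := key (Num.bound `|complex.Re q|); rewrite lecE => /andP[_].
rewrite raddfMn /= => le_q.
have := archi_boundP (normr_ge0 (complex.Re q)).
by rewrite ltNge (le_trans le_q (ler_norm _)).
Qed.

End circle_characters.

Theorem theorem7p1 (R : realType) (alpha beta : Loo R) :
  compact_operator (singular_op alpha beta) -> alpha = 0 /\ beta = 0.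
Proof.
move=> cpt; split.
(* [Posz] lists the characters fixed by [projP], on which only [alpha] acts. *)
- apply: (cLspace_mul_char_precompact (k := Posz) _ cpt) => [m n []//|n].
  exists (circle_char R n); first by rewrite /= L2_norm_char.
  by rewrite /singular_op /projQ projP_char_ge0// subrr cLspace_mul0r addr0.
(* [Negz n] is [- (n + 1)], so [Negz] lists exactly the characters killed by [projP], on which only
   [beta] acts. *)
- apply: (cLspace_mul_char_precompact (k := Negz) _ cpt) => [m n []//|n].
  exists (circle_char R (Negz n)); first by rewrite /= L2_norm_char.
  by rewrite /singular_op /projQ projP_char_lt0// subr0 cLspace_mul0r add0r.
Qed.
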